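(* Let $D=\frac{d}{dt}$. For every simple graph $G$ with complement $\bar G$, the following duality relations hold: (1) $\pi_G(t)=\phi_\pi\left[\pi^+_{\bar G}(t)\right]$, where $\phi_\pi=e^{tD^2}$; (2) $\chi_G(t)=\phi_\chi\left[\xi_{\bar G}(t)\right]$, where $\phi_\chi$ is the linear operator on polynomials with $\phi_\chi[t^n]=(t)_n=t(t-1)\cdots(t-n+1)$ for all $n$; (3) $\xi_G(t)=\phi_\xi\left[\chi_{\bar G}(t)\right]$, where $\phi_\xi$ is the linear operator on polynomials with $\phi_\xi[t^n]=\sum_{k=1}^n S(n,k)\,t^k$ for all $n\ge 1$, with $S(n,k)$ the Stirling number of the second kind.
   Context: Graphs are finite, without loops or multiple edges, and have $n\ge 1$ vertices. The operator $e^{tD^2}$ acts on polynomials by $e^{tD^2}[p]=\sum_{k\ge 0}\frac{1}{k!}(tD^2)^k[p]$, where $tD^2$ is the linear operator $p(t)\mapsto t\,p''(t)$ (the sum is finite for each polynomial). A $k$-path cover of $G$ is a set of $k$ vertex-disjoint directed paths in $G$ covering all vertices, where single vertices count as (trivial) paths, and a path with at least two vertices traversed in its two opposite directions gives two different directed paths. Let $p_k(G)$ be the number of $k$-path covers. The path-cover polynomial is $\pi_G(t)=\sum_{k=1}^n p_k(G)t^k$, and the signed path-cover polynomial is $\pi_G^+(t)=\sum_{k=1}^n(-1)^{n-k}p_k(G)t^k$. A $k$-clique-cover of $G$ is a set of $k$ vertex-disjoint (nonempty) cliques covering all vertices, single vertices being allowed as cliques; $s_k(G)$ is the number of $k$-clique-covers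 and $\xi_G(t)=\sum_{k=1}^n s_k(G)t^k$ is the clique-cover polynomial. $\chi_G(t)$ is the chromatic polynomial (the polynomial whose value at each nonnegative integer $t$ is the number of proper colorings of $G$ with $t$ colors). *)

(* Defs.v *)
From HB Require Import structures.
From mathcomp Require Import all_boot all_order all_algebra.

Set Implicit Arguments.
Unset Strict Implicit.
Unset Printing Implicit Defensive.

Import Order.TTheory GRing.Theory Num.Theory.
Local Open Scope ring_scope.

(* Graphs are symmetric irreflexive relations on a finType; the complement
   excludes the diagonal so that it is again irreflexive. *)
Definition compl (T : finType) (e : rel T) : rel T :=
  [rel x y | (x != y) && ~~ e x y].

Lemma compl_sym (T : finType) (e : rel T) : symmetric e -> symmetric (compl e).
Proof. by move=> es x y; rewrite /compl /= eq_sym es. Qed.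

Lemma compl_irr (T : finType) (e : rel T) : irreflexive (compl e).
Proof. by move=> x; rewrite /compl /= eqxx. Qed.

Definition dpath (T : finType) (e : rel T) (s : seq T) : bool :=
  if s is x :: s' then path e x s' && uniq s else false.

(* Sequences of length at most #|T| suffice, since a dpath has no repetition;
   this makes the type of sets of directed paths finite. *)
Definition path_cover (T : finType) (e : rel T) (C : {set #|T|.-bseq T}) : bool :=
  [&& [forall s in C, dpath e s],
      [forall s in C, forall s' in C, (s != s') ==> [disjoint s & s']]
    & [forall x, exists s in C, x \in s]].

Definition num_path_covers (T : finType) (e : rel T) (k : nat) : nat :=
  #|[set C : {set #|T|.-bseq T} | path_cover e C & #|C| == k]|.

Definition path_cover_poly (T : finType) (e : rel T) : {poly rat} :=
  \sum_(1 <= k < #|T|.+1) (num_path_covers e k)%:R *: 'X^k.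

Definition signed_path_cover_poly (T : finType) (e : rel T) : {poly rat} :=
  \sum_(1 <= k < #|T|.+1)
     ((-1) ^+ (#|T| - k) * (num_path_covers e k)%:R) *: 'X^k.

Definition clique (T : finType) (e : rel T) (A : {set T}) : bool :=
  [forall x in A, forall y in A, (x != y) ==> e x y].

Definition num_clique_covers (T : finType) (e : rel T) (k : nat) : nat :=
  #|[set P : {set {set T}} | [&& partition P [set: T],
       [forall A in P, clique e A] & #|P| == k]]|.

Definition clique_cover_poly (T : finType) (e : rel T) : {poly rat} :=
  \sum_(1 <= k < #|T|.+1) (num_clique_covers e k)%:R *: 'X^k.

Definition proper_coloring (T : finType) (e : rel T) (C : finType)
    (f : {ffun T -> C}) : bool :=
  [forall x, forall y, e x y ==> (f x != f y)].

Definition num_colorings (T : finType) (e : rel T) (q : nat) : nat :=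
  #|[set f : {ffun T -> 'I_q} | proper_coloring e f]|.

Definition falling_poly (n : nat) : {poly rat} := \prod_(i < n) ('X - i%:R%:P).

Definition stirling2 (n k : nat) : nat :=
  #|[set P : {set {set 'I_n}} | partition P [set: 'I_n] & #|P| == k]|.

Definition tD2 (p : {poly rat}) : {poly rat} := 'X * p^`()^`().

(* The exponential series, truncated at size p: the remaining terms vanish,
   see iter_tD2_eq0 and exp_tD2E. *)
Definition exp_tD2 (p : {poly rat}) : {poly rat} :=
  \sum_(k < size p) (k`!%:R)^-1 *: iter k tD2 p.

Lemma size_tD2 (p : {poly rat}) : (size (tD2 p) <= (size p).-1)%N.
Proof.
have [p0|p0] := eqVneq p^`()^`() 0; first by rewrite /tD2 p0 mulr0 size_poly0.
have d0 : p^`() != 0 by apply: contra_neq p0 => ->; rewrite linear0.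
have p'0 : p != 0 by apply: contra_neq d0 => ->; rewrite linear0.
rewrite /tD2 mulrC size_mulX //.
by apply: leq_trans (lt_size_deriv d0) _; rewrite -ltnS (ltn_predK (lt_size_deriv p'0)) lt_size_deriv.
Qed.

Lemma iter_tD2_eq0 (p : {poly rat}) k : (size p <= k)%N -> iter k tD2 p = 0.
Proof.
move=> le_pk; apply/eqP; rewrite -size_poly_eq0 -leqn0.
have: (size (iter k tD2 p) <= size p - k)%N.
  elim: k {le_pk} => [|k IH] /=; first by rewrite subn0.
  apply: leq_trans (size_tD2 _) _; rewrite subnS.
  by rewrite -!subn1 leq_sub2r.
by move/leq_trans; apply; rewrite leqn0 subn_eq0.
Qed.

Lemma exp_tD2E (p : {poly rat}) m : (size p <= m)%N ->
  exp_tD2 p = \sum_(k < m) (k`!%:R)^-1 *: iter k tD2 p.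
Proof.
move=> lepm; rewrite /exp_tD2 -[LHS](big_mkord xpredT (fun k => (k`!%:R)^-1 *: iter k tD2 p)).
rewrite -[RHS](big_mkord xpredT (fun k => (k`!%:R)^-1 *: iter k tD2 p)).
rewrite (big_cat_nat (leq0n _) lepm) //= [X in _ = _ + X]big_nat [X in _ = _ + X]big1 ?addr0 //.
by move=> k /andP[lepk _]; rewrite iter_tD2_eq0 ?scaler0.
Qed.

(* A linear operator with arbitrary prescribed values on the monomials exists. *)
Definition monomial_ext (b : nat -> {poly rat}) (p : {poly rat}) : {poly rat} :=
  \sum_(i < size p) p`_i *: b i.

Lemma monomial_extE b (p : {poly rat}) m : (size p <= m)%N ->
  monomial_ext b p = \sum_(i < m) p`_i *: b i.
Proof.
move=> lepm; rewrite /monomial_ext -[LHS](big_mkord xpredT (fun k => p`_k *: b k)).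
rewrite -[RHS](big_mkord xpredT (fun k => p`_k *: b k)).
rewrite (big_cat_nat (leq0n _) lepm) //= [X in _ = _ + X]big_nat [X in _ = _ + X]big1 ?addr0 //.
by move=> k /andP[lepk _]; rewrite nth_default ?scale0r.
Qed.

Lemma monomial_ext_is_linear b : linear (monomial_ext b).
Proof.
move=> a p q; set m := maxn (size p) (size q).
have lep : (size p <= m)%N by rewrite leq_maxl.
have lemq : (size q <= m)%N by rewrite leq_maxr.
have leD : (size (a *: p + q)%R <= m)%N.
  apply: leq_trans (size_polyD _ _) _.
  by rewrite geq_max lemq andbT (leq_trans (size_scale_leq _ _)).
rewrite !(@monomial_extE _ _ m) // scaler_sumr -big_split /=.
by apply: eq_bigr => i _; rewrite coefD coefZ scalerDl scalerA.
Qed.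

HB.instance Definition _ b :=
  GRing.isLinear.Build rat {poly rat} {poly rat} *:%R (monomial_ext b)
    (monomial_ext_is_linear b).

Lemma monomial_extXn b n : monomial_ext b 'X^n = b n.
Proof.
rewrite /monomial_ext size_polyXn big_ord_recr /= coefXn eqxx scale1r.
by rewrite big1 ?add0r // => i _; rewrite coefXn ltn_eqF ?scale0r.
Qed.

Section Chromatic.
Variables (T : finType) (e : rel T).

Let surj k := #|[set f : {ffun T -> 'I_k} |
  proper_coloring e f & f @: setT == setT]|.

Lemma surj_eq0 k : (#|T| < k)%N -> surj k = 0%N.
Proof.
move=> ltk; apply/eqP; rewrite cards_eq0; apply/eqP/setP => f; rewrite !inE.
apply/negbTE/negP => /andP[_ /eqP E].
have := leq_imset_card f [set: T]; rewrite E !cardsT card_ord.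
by rewrite leqNgt ltk.
Qed.

Lemma num_colorings_image q (A : {set 'I_q}) :
  #|[set f : {ffun T -> 'I_q} | proper_coloring e f & f @: setT == A]|
    = surj #|A|.
Proof.
pose h (g : {ffun T -> 'I_#|A|}) : {ffun T -> 'I_q} := [ffun x => enum_val (g x)].
have hinj : injective h.
  move=> g1 g2 /ffunP E; apply/ffunP => x; have := E x.
  by rewrite !ffunE => /enum_val_inj.
rewrite /surj -(card_imset _ hinj); apply: eq_card => f; rewrite inE.
apply/andP/imsetP => [[/forallP pf /eqP fA]|[g]].
  have fin x : f x \in A by rewrite -fA imset_f ?inE.
  exists [ffun x => enum_rank_in (fin x) (f x)]; last first.
    by apply/ffunP => x; rewrite !ffunE enum_rankK_in.
  rewrite inE; apply/andP; split.
    apply/forallP => x; apply/forallP => y; apply/implyP => exy.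
    move/forallP/(_ y)/implyP/(_ exy): (pf x); rewrite !ffunE.
    by apply: contra_neq => /(congr1 enum_val); rewrite !enum_rankK_in.
  apply/eqP/setP => i; rewrite inE; apply/imsetP.
  have := enum_valP i; rewrite -{2}fA => /imsetP[x _ Ex].
  by exists x => //; rewrite ffunE; apply: enum_val_inj; rewrite enum_rankK_in.
rewrite inE => /andP[/forallP pg /eqP gs] ->; split.
  apply/forallP => x; apply/forallP => y; apply/implyP => exy.
  move/forallP/(_ y)/implyP/(_ exy): (pg x); rewrite !ffunE.
  by apply: contra_neq => /enum_val_inj.
apply/eqP/setP => a; apply/imsetP/idP => [[x _ ->]|aA].
  by rewrite ffunE enum_valP.
have: enum_rank_in aA a \in g @: setT by rewrite gs inE.
by case/imsetP=> x _ Ex; exists x => //; rewrite ffunE -Ex enum_rankK_in.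
Qed.

Lemma horner_falling_poly n q : (falling_poly n).[q%:R] = (q ^_ n)%:R.
Proof.
rewrite /falling_poly horner_prod; elim: n => [|n IH]; first by rewrite big_ord0.
rewrite big_ord_recr /= {}IH !hornerE ffactnSr natrM.
have [leq|ltq] := leqP n q; first by rewrite natrB.
by rewrite ffact_small ?mul0r.
Qed.

Lemma chromatic_poly_sig :
  {p : {poly rat} | forall q : nat, p.[q%:R] = (num_colorings e q)%:R}.
Proof.
exists (\sum_(k < #|T|.+1) ((surj k)%:R / k`!%:R) *: falling_poly k) => q.
have -> : num_colorings e q = (\sum_(k < #|T|.+1) surj k * 'C(q, k))%N.
  rewrite /num_colorings -sum1_card.
  rewrite (partition_big (fun f : {ffun T -> 'I_q} => f @: setT) xpredT) //=.
  under eq_bigr => A _.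
    rewrite (_ : (\sum_(_ | _) 1)%N = surj #|A|); first over.
    rewrite -num_colorings_image -sum1_card.
    by apply: eq_bigl => f; rewrite !inE.
  rewrite (bigID (fun A : {set 'I_q} => (#|A| < #|T|.+1)%N)) /= addnC.
  rewrite big1 ?add0n; last by move=> A; rewrite -leqNgt => /surj_eq0.
  rewrite (partition_big (fun A : {set 'I_q} => inord #|A| : 'I_#|T|.+1) xpredT) //=.
  apply: eq_bigr => k _.
  have -> : 'C(q, k) = #|[set A : {set 'I_q} | #|A| == k]|.
    by rewrite card_draws card_ord.
  rewrite -[X in (_ * X)%N]sum1_card big_distrr /=.
  rewrite (eq_bigl (fun A : {set 'I_q} => A \in [set A : {set 'I_q} | #|A| == k])); last first.
    move=> A; rewrite inE; apply/andP/eqP => [[lt /eqP <-]|->].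
      by rewrite inordK.
    by rewrite ltn_ord inord_val eqxx.
  by apply: eq_bigr => A; rewrite inE => /eqP ->; rewrite muln1.
rewrite horner_sum natr_sum; apply: eq_bigr => k _.
rewrite hornerZ horner_falling_poly -bin_ffact !natrM -mulrA; congr (_ * _).
by rewrite mulrCA mulVf ?mulr1 // pnatr_eq0 -lt0n fact_gt0.
Qed.

End Chromatic.

(* Specified by its values at the natural numbers, see chromatic_polyE. *)
Definition chromatic_poly (T : finType) (e : rel T) : {poly rat} :=
  sval (chromatic_poly_sig e).

Lemma chromatic_polyE (T : finType) (e : rel T) (q : nat) :
  (chromatic_poly e).[q%:R] = (num_colorings e q)%:R.
Proof. exact: (svalP (chromatic_poly_sig e)). Qed.

(* Main.v *)
(* For (2), the fibres of a proper colouring of G form a clique cover of the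
   complement, and a partition P into cliques of the complement arises from
   (q)_|P| colourings with q colours.  Applied to the edgeless graph, this reads
   t^n = sum_k S(n,k) (t)_k, so that phi_xi inverts phi_chi on polynomials
   without constant term, and (3) follows from (2).

   For (1), the k! orderings of a k-path cover are the ways of cutting a linear
   order w of the vertices into k paths.  Adjacent vertices x, y of w may always
   be cut apart, and may be left together if xy is an edge; so, with L the linear
   map X^i -> t^(i+1)/(i+1)! (exp_shift), pi_G is the image under L of
   the sum over w of the products of ('X + [xy is an edge]), and the signed
   polynomial of the complement that of the products of ('X - 1 + [xy is an
   edge]).  These differ by the shift 'X -> 'X + 1, that is by exp(D), and
   (t D^2) L = L D turns exp(D) into exp(t D^2). *)
Require Import Defs.
From HB Require Import structures.
From mathcomp Require Import all_boot all_order all_algebra.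
From mathcomp Require Import zify.

Set Implicit Arguments.
Unset Strict Implicit.
Unset Printing Implicit Defensive.

Import Order.TTheory GRing.Theory Num.Theory.
Local Open Scope ring_scope.

(** * Polynomial identities from values, and sums grouped by a count *)

Lemma poly_eq_nat (p q : {poly rat}) :
  (forall n : nat, p.[n%:R] = q.[n%:R]) -> p = q.
Proof.
move=> Epq; apply/eqP; rewrite -subr_eq0; apply/eqP.
apply: (@roots_geq_poly_eq0 _ _ [seq n%:R | n <- iota 0 (size (p - q))]).
- by apply/allP => _ /mapP[n _ ->]; rewrite rootE !hornerE Epq subrr.
- by rewrite map_inj_uniq ?iota_uniq // => m n /eqP; rewrite eqr_nat => /eqP.
- by rewrite size_map size_iota.
Qed.

(** Bridges the cover polynomials, defined by counting covers with [k] parts, and sums over the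
    covers themselves. *)
Lemma sum_by_value (V : nmodType) (I : Type) (r : seq I) (P : pred I)
    (h : I -> nat) (F : nat -> V) n :
  (forall i, P i -> (0 < h i <= n)%N) ->
  \sum_(i <- r | P i) F (h i)
    = \sum_(1 <= k < n.+1) F k *+ count (fun i => P i && (h i == k)) r.
Proof.
move=> hP; rewrite big_add1 /= big_mkord.
rewrite -(big_mkord xpredT
  (fun k => F k.+1 *+ count (fun i => P i && (h i == k.+1)) r)).
elim: r => [|i r IH]; first by rewrite big_nil big1.
rewrite big_cons IH; under [RHS]eq_bigr do rewrite /= mulrnDr.
rewrite big_split /=; case: ifP => [/[dup] Pi /hP hi|_]; last first.
  by rewrite [X in _ = X + _]big1 ?add0r.
congr (_ + _); rewrite big_mkord.
have lt_hi : ((h i).-1 < n)%N by case: (h i) hi.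
have hE : (h i).-1.+1 = h i by case: (h i) hi.
rewrite (bigD1 (Ordinal lt_hi)) //= hE eqxx mulr1n big1 ?addr0 // => k.
rewrite -val_eqE /= => neq; case: eqP => // hk.
by case/negP: neq; rewrite hk.
Qed.

Lemma sum_card_by_value (V : nmodType) (I : finType) (P : pred I)
    (h : I -> nat) (F : nat -> V) n :
  (forall i, P i -> (0 < h i <= n)%N) ->
  \sum_(i | P i) F (h i)
    = \sum_(1 <= k < n.+1) F k *+ #|[set i | P i & h i == k]|.
Proof.
move=> hP; rewrite (@sum_by_value _ _ _ P h F n hP); apply: eq_bigr => k _.
congr (_ *+ _); rewrite -sum1_count -sum1_card; apply: eq_bigl => i.
by rewrite inE.
Qed.

Lemma card_partition_bounds (T : finType) (P : {set {set T}}) :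
  (0 < #|T|)%N -> partition P [set: T] -> (0 < #|P| <= #|T|)%N.
Proof.
move=> T0 Ppart; have [x _] := card_gt0P T0.
have [/eqP cP _ P0] := and3P Ppart; apply/andP; split.
  by apply/card_gt0P; exists (pblock P x); rewrite pblock_mem ?cP ?inE.
rewrite -cardsT (card_partition Ppart) -sum1_card; apply: leq_sum => A AP.
by rewrite card_gt0; apply: contraNneq P0 => <-.
Qed.

(** * Clique partitions as fibres of proper colourings *)

Section CliqueCovers.
Variables (T : finType) (e : rel T).

Definition clique_partition (P : {set {set T}}) : bool :=
  partition P [set: T] && [forall A in P, clique e A].

Lemma clique_cover_polyE : (0 < #|T|)%N ->
  clique_cover_poly e = \sum_(P | clique_partition P) 'X^#|P|.
Proof.
move=> T0; rewrite (@sum_card_by_value _ _ _ (fun P : {set {set T}} => #|P|)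
  (fun k => 'X^k) #|T|); last first.
  by move=> P /andP[/(card_partition_bounds T0)].
apply: eq_bigr => k _; rewrite scaler_nat; congr (_ *+ _).
by apply: eq_card => P; rewrite !inE andbA.
Qed.

End CliqueCovers.

(** Turns equality of partitions into a condition on pairs of vertices, used both to count
    colourings with given fibres and to test properness. *)
Lemma preim_partition_eqP (T : finType) (C : eqType) (f : T -> C)
    (P : {set {set T}}) : partition P [set: T] ->
  reflect (forall x y, (f x == f y) = (pblock P x == pblock P y))
          (preim_partition f [set: T] == P).
Proof.
move=> Ppart; have [/eqP cP tP _] := and3P Ppart.
have blkE x y : (pblock P x == pblock P y) = (y \in pblock P x).
  by rewrite eq_pblock // cP inE.
apply: (iffP eqP) => [<- x y|Ef].
  have /and3P[/eqP cf tf _] := preim_partitionP f [set: T].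
  rewrite eq_pblock ?cf ?inE // /preim_partition.
  rewrite pblock_equivalence_partition ?inE // => a b c _ _ _.
  by split=> // /eqP ->.
rewrite -[RHS](equivalence_partition_pblock Ppart) /preim_partition.
rewrite /equivalence_partition; apply: eq_imset => x; apply/setP => y.
by rewrite !inE Ef blkE.
Qed.

(** A colouring with fibres [P] amounts to an injection of the blocks of [P] into the colours. *)
Lemma card_preim_partition (T C : finType) (P : {set {set T}}) :
  partition P [set: T] ->
  #|[set f : {ffun T -> C} | preim_partition f [set: T] == P]|
    = (#|C| ^_ #|P|)%N.
Proof.
move=> Ppart; have [/eqP cP tP P0] := and3P Ppart.
have inP x : pblock P x \in P by rewrite pblock_mem ?cP ?inE.
pose blk x : {A | A \in P} := Sub (pblock P x) (inP x).
(* Chooses a vertex in each block, through which such a colouring descends to the blocks. *)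
have blk_surj B : {x | blk x = B}.
  case: B => A AP; have A0: A != set0 by apply: contraNneq P0 => <-.
  have [x xA] := sigW (set0Pn _ A0); exists x; apply: val_inj => /=.
  exact: def_pblock.
pose h (g : {ffun {A | A \in P} -> C}) : {ffun T -> C} := [ffun x => g (blk x)].
have h_inj : injective h.
  move=> g1 g2 /ffunP E; apply/ffunP => B; have [x <-] := blk_surj B.
  by have := E x; rewrite !ffunE.
transitivity #|[set g : {ffun {A | A \in P} -> C} | injectiveb g]|; last first.
  by rewrite card_inj_ffuns card_sig.
rewrite -(card_imset _ h_inj); apply: eq_card => f; rewrite inE.
apply/preim_partition_eqP/imsetP => // [Ef|[g]].
  exists [ffun B => f (sval (blk_surj B))].
    rewrite inE; apply/injectiveP => A B; rewrite !ffunE => /eqP; rewrite Ef.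
    move=> /eqP E; rewrite -(svalP (blk_surj A)) -(svalP (blk_surj B)).
    exact: val_inj.
  apply/ffunP => x; rewrite !ffunE; apply/eqP; rewrite Ef.
  by case: (blk_surj _) => y /= /(congr1 val) /= ->.
rewrite inE => /injectiveP g_inj -> x y.
by rewrite !ffunE (inj_eq g_inj) -val_eqE.
Qed.

Lemma proper_coloring_preim (T C : finType) (e : rel T) (f : {ffun T -> C}) :
  irreflexive e ->
  proper_coloring e f = clique_partition (compl e) (preim_partition f [set: T]).
Proof.
move=> e_irr; set P := preim_partition _ _.
have Ppart : partition P [set: T] by apply: preim_partitionP.
have /preim_partition_eqP - /(_ Ppart) fE : P == P by [].
have [/eqP cP tP P0] := and3P Ppart; rewrite /clique_partition Ppart /=.
apply/forallP/forall_inP => [fP A AP|cl x].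
  apply/forall_inP => x xA; apply/forall_inP => y yA; apply/implyP => neq.
  rewrite /compl /= neq; apply/negP => exy.
  have /forallP/(_ y)/implyP/(_ exy) := fP x.
  by rewrite fE !(def_pblock tP AP) ?eqxx.
apply/forallP => y; apply/implyP => exy; rewrite fE; apply/negP => /eqP E.
have inP : pblock P x \in P by rewrite pblock_mem ?cP ?inE.
have /forall_inP/(_ x) := cl _ inP; rewrite mem_pblock cP inE => /(_ isT).
(* For an edge inside one block, the clique condition in the complement forces [x = y], against
   irreflexivity. *)
move/forall_inP/(_ y); rewrite E mem_pblock cP inE => /(_ isT).
rewrite /compl /= exy andbF implybF negbK => /eqP xy.
by rewrite xy e_irr in exy.
Qed.

Lemma num_coloringsE (T : finType) (e : rel T) q : irreflexive e ->
  num_colorings e q = (\sum_(P | clique_partition (compl e) P) q ^_ #|P|)%N.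
Proof.
move=> e_irr; rewrite /num_colorings -sum1_card.
rewrite (partition_big (fun f : {ffun T -> 'I_q} => preim_partition f [set: T])
  (clique_partition (compl e))) /=; last first.
  by move=> f; rewrite inE proper_coloring_preim.
apply: eq_bigr => P PP; have /andP[Ppart _] := PP.
transitivity (#|'I_q| ^_ #|P|)%N; last by rewrite card_ord.
rewrite -(card_preim_partition _ Ppart) -sum1_card.
apply: eq_bigl => f; rewrite !inE proper_coloring_preim //.
by case: eqP => [->|]; rewrite ?PP ?andbF.
Qed.

Lemma chromatic_poly_falling (T : finType) (e : rel T) : irreflexive e ->
  chromatic_poly e = \sum_(P | clique_partition (compl e) P) falling_poly #|P|.
Proof.
move=> e_irr; apply: poly_eq_nat => q.
rewrite chromatic_polyE num_coloringsE // natr_sum horner_sum.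
by apply: eq_bigr => P _; rewrite horner_falling_poly.
Qed.

(** The double complement can differ from [e] only on the diagonal, which [clique] does not test. *)
Lemma clique_partition_complK (T : finType) (e : rel T) :
  clique_partition (compl (compl e)) =1 clique_partition e.
Proof.
move=> P; congr (_ && _); apply: eq_forallb_in => A _.
apply: eq_forallb_in => x _; apply: eq_forallb_in => y _.
by rewrite /compl /=; case: eqVneq => //=; rewrite negbK.
Qed.

(** * Falling factorials, Stirling numbers and the chromatic dualities *)

Lemma Xn_falling n : (0 < n)%N ->
  'X^n = \sum_(1 <= k < n.+1) (stirling2 n k)%:R *: falling_poly k.
Proof.
(* In the edgeless graph every map is a proper colouring, and every vertex set is a clique of the
   complement. *)
move=> n0; pose e0 : rel 'I_n := fun _ _ => false.
have -> : 'X^n = chromatic_poly e0.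
  apply: poly_eq_nat => q; rewrite chromatic_polyE hornerXn -natrX; congr _%:R.
  transitivity #|{ffun 'I_n -> 'I_q}|; first by rewrite card_ffun !card_ord.
  rewrite -cardsT; apply: eq_card => f; rewrite !inE; symmetry.
  by apply/forallP => x; apply/forallP.
rewrite chromatic_poly_falling //.
rewrite (@sum_card_by_value _ _ _ (fun P : {set {set 'I_n}} => #|P|)
  falling_poly n); last first.
  by move=> P /andP[/card_partition_bounds]; rewrite card_ord => /(_ n0).
apply: eq_bigr => k _; rewrite scaler_nat; congr (_ *+ _).
apply: eq_card => P; rewrite !inE /clique_partition; congr (_ && _).
rewrite [X in _ && X](_ : _ = true) ?andbT //.
apply/forall_inP => A _; apply/forall_inP => x _; apply/forall_inP => y _.
by rewrite /compl /= andbT implybb.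
Qed.

Lemma falling_poly_monic n : falling_poly n \is monic.
Proof. by rewrite monic_prod // => i _; apply: monicXsubC. Qed.

Lemma size_falling_poly n : size (falling_poly n) = n.+1.
Proof.
by rewrite /falling_poly size_prod_XsubC /index_enum -enumT size_enum_ord.
Qed.

(** Triangularity: [falling_poly n] is monic of degree [n], so the image of a nonzero [p] has the
    leading coefficient of [p] in the same degree. *)
Lemma monomial_ext_falling_inj : injective (monomial_ext falling_poly).
Proof.
apply: raddf_inj => p; apply: contra_eq => p0; have Ep := polySpred p0.
apply: contra_neq p0 => /(congr1 (coefp (size p).-1)) /=; rewrite coef0.
rewrite /monomial_ext Ep /= big_ord_recr coefD coef_sum big1 ?add0r => [|i _].
  have := monicP (falling_poly_monic (size p).-1).
  rewrite lead_coefE size_falling_poly /= coefZ => -> /eqP.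
  by rewrite mulr1 lead_coef_eq0 => /eqP.
rewrite coefZ [(falling_poly _)`_ _]nth_default ?mulr0 // size_falling_poly.
exact: (ltn_ord i).
Qed.

(** On each positive power of ['X] this is [Xn_falling]; [phi] is unspecified on constants, whence
    the condition on the constant term. *)
Lemma falling_stirling_id (phi : {linear {poly rat} -> {poly rat}})
    (q : {poly rat}) :
  (forall n : nat, (1 <= n)%N ->
     phi 'X^n = \sum_(1 <= k < n.+1) (stirling2 n k)%:R *: 'X^k) ->
  q`_0 = 0 -> monomial_ext falling_poly (phi q) = q.
Proof.
move=> phiX q0; rewrite -[q in LHS]coefK poly_def !raddf_sum.
rewrite -[RHS]coefK poly_def; apply: eq_bigr => -[[|n] /= _] _.
  by rewrite q0 !scale0r !raddf0.
rewrite !linearZ; congr (_ *: _); rewrite phiX // Xn_falling // linear_sum.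
by apply: eq_bigr => k _; rewrite linearZ; congr (_ *: _);
  apply: monomial_extXn.
Qed.

Lemma chromatic_dual (T : finType) (e : rel T)
    (phi : {linear {poly rat} -> {poly rat}}) :
  irreflexive e -> (0 < #|T|)%N -> (forall n, phi 'X^n = falling_poly n) ->
  chromatic_poly e = phi (clique_cover_poly (compl e)).
Proof.
move=> e_irr T0 phiX; rewrite chromatic_poly_falling // clique_cover_polyE //.
by rewrite linear_sum; apply: eq_bigr => P _; rewrite phiX.
Qed.

(** Apply the injective [monomial_ext falling_poly] to both sides: it cancels [phi] on the right,
    and [chromatic_dual] for [compl e] evaluates the left. *)
Lemma clique_cover_dual (T : finType) (e : rel T)
    (phi : {linear {poly rat} -> {poly rat}}) :
  (0 < #|T|)%N ->
  (forall n : nat, (1 <= n)%N ->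
     phi 'X^n = \sum_(1 <= k < n.+1) (stirling2 n k)%:R *: 'X^k) ->
  clique_cover_poly e = phi (chromatic_poly (compl e)).
Proof.
move=> T0 phiX; apply: monomial_ext_falling_inj.
rewrite falling_stirling_id //; last first.
  (* The constant term counts colourings with no colour, and a graph with a vertex has none. *)
  have := chromatic_polyE (compl e) 0; rewrite horner_coef0 => ->.
  have [x _] := card_gt0P T0; apply/eqP; rewrite pnatr_eq0 cards_eq0.
  by apply/eqP/setP => f; have [] := f x.
rewrite (chromatic_dual (phi := monomial_ext falling_poly)) //.
- congr (monomial_ext _ _); rewrite !clique_cover_polyE //.
  by apply: eq_bigl => P; rewrite clique_partition_complK.
- exact: compl_irr.
- exact: monomial_extXn.
Qed.

(** * The exponential of [tD2] as a shift *)

Definition exp_shift : {poly rat} -> {poly rat} :=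
  monomial_ext (fun i => (i.+1`!%:R)^-1 *: 'X^(i.+1)).

HB.instance Definition _ :=
  GRing.isLinear.Build rat {poly rat} {poly rat} *:%R exp_shift
    (monomial_ext_is_linear _).

(** The exponent [i] counts cuts, which leave [i + 1] paths; the factorial forgets the order of
    these paths. *)
Lemma exp_shiftXn i : exp_shift 'X^i = (i.+1`!%:R)^-1 *: 'X^(i.+1).
Proof. exact: monomial_extXn. Qed.

Lemma coef_exp_shift p j :
  (exp_shift p)`_j = if j is i.+1 then p`_i / j`!%:R else 0.
Proof.
rewrite /exp_shift /monomial_ext coef_sum.
under eq_bigr do rewrite !coefZ coefXn.
case: j => [|j]; first by rewrite big1 // => i _; rewrite !mulr0.
have [lt_j|le_j] := ltnP j (size p); last first.
  rewrite nth_default // mul0r big1 // => i _.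
  by rewrite eqSS gtn_eqF ?mulr0 // (leq_trans (ltn_ord i)).
rewrite (bigD1 (Ordinal lt_j)) //= eqxx mulr1 big1 ?addr0 // => i neq.
by rewrite eqSS eq_sym (negbTE (_ : val i != j)) ?mulr0.
Qed.

Lemma size_exp_shift p : (size (exp_shift p) <= (size p).+1)%N.
Proof.
apply/leq_sizeP => -[|j] // le_j.
by rewrite coef_exp_shift nth_default ?mul0r.
Qed.

(** At ['X^i] both sides are t^i/(i-1)! for i > 0, and 0 for i = 0. *)
Lemma tD2_exp_shift p : tD2 (exp_shift p) = exp_shift p^`().
Proof.
apply/polyP => -[|j]; first by rewrite coefXM coef_exp_shift.
rewrite coefXM coef_deriv [_^`()`_j.+1]coef_deriv !coef_exp_shift coef_deriv.
rewrite mulrnAC -mulrnAl -mulrnAr; congr (_ * _).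
by rewrite factS natrM invfM -mulr_natl mulVKf ?pnatr_eq0.
Qed.

(** Taylor's formula with increment 1. *)
Lemma sum_nderivn (p : {poly rat}) :
  \sum_(i < size p) p^`N(i) = p \Po ('X + 1).
Proof.
apply: poly_eq_nat => n.
rewrite horner_comp !hornerE nderiv_taylor; last exact: commr1.
by rewrite horner_sum; apply: eq_bigr => i _; rewrite expr1n mulr1.
Qed.

Lemma exp_tD2_exp_shift p : exp_tD2 (exp_shift p) = exp_shift (p \Po ('X + 1)).
Proof.
rewrite (exp_tD2E (size_exp_shift p)) -sum_nderivn.
have iterE k : iter k tD2 (exp_shift p) = exp_shift p^`(k).
  by elim: k => //= k ->; rewrite tD2_exp_shift.
(* The size bound for [exp_shift p] is one above that of [p]; the extra term contains a vanishing
   derivative. *)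
rewrite big_ord_recr /= iterE derivn_poly0 // raddf0 scaler0 addr0.
rewrite linear_sum; apply: eq_bigr => k _; rewrite iterE -linearZ.
congr exp_shift.
rewrite nderivn_def -scaler_nat scalerA mulVf ?scale1r //.
by rewrite pnatr_eq0 -lt0n fact_gt0.
Qed.

(** * Cutting a linear order into paths *)

Section LinearSplittings.
Variables (T : eqType) (e : rel T).
Implicit Types (x : T) (s p : seq T) (ss : seq (seq T)).

(** This is [dpath] without distinctness, which will come from the linear order being cut. *)
Definition is_path p : bool := if p is x :: p' then path e x p' else false.

Definition push_head x ss : seq (seq T) :=
  if ss is p :: ss' then (x :: p) :: ss' else [::].

Fixpoint splittings x s : seq (seq (seq T)) :=
  if s is y :: s' then
    map (cons [:: x]) (splittings y s') ++
    (if e x y then map (push_head x) (splittings y s') else [::])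
  else [:: [:: [:: x]]].

(** The first path is either [[:: x]] or continues to the next vertex along an edge: these are the
    two branches of [splittings]. *)
Lemma mem_splittings x s ss :
  (ss \in splittings x s) = (flatten ss == x :: s) && all is_path ss.
Proof.
elim: s x ss => [|y s IH] x ss /=.
  rewrite inE; case: ss => [|[|z [|u p]] ss] //=; rewrite ?andbF //.
    by case: ss => [|[|v q] ss]; rewrite /= !eqseq_cons ?andbF.
  by rewrite !eqseq_cons !andbF.
rewrite mem_cat.
have -> : (ss \in map (cons [:: x]) (splittings y s)) =
   if ss is [:: z] :: ss' then (x == z) && (ss' \in splittings y s) else false.
  apply/mapP/idP => [[r rin ->]|]; first by rewrite eqxx.
  case: ss => [|[|z [|u p]] ss] // /andP[/eqP <- ssin].
  by exists ss.
have -> : (ss \in if e x y then map (push_head x) (splittings y s) else [::]) =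
   if ss is (z :: u :: p) :: ss'
   then [&& e x y, x == z & (u :: p) :: ss' \in splittings y s] else false.
  case: ifP => exy; last by case: ss => [|[|z [|u p]] ss].
  apply/mapP/idP => [[[|[|u p] r] rin ->]|] /=.
  - by rewrite IH in rin.
  - by move: rin; rewrite IH /= andbF.
  - by rewrite eqxx.
  case: ss => [|[|z [|u p]] ss] // /andP[/eqP <- ssin].
  by exists ((u :: p) :: ss).
case: ss => [|[|z [|u p]] ss] //=; first by rewrite andbF.
  by rewrite orbF IH eqseq_cons eq_sym -andbA.
rewrite IH /= !eqseq_cons [z == x]eq_sym.
case: (x =P z) => [<-|]; rewrite ?andbF //=.
by case: (u =P y) => [->|]; rewrite ?andbF //= andbCA !andbA.
Qed.

Lemma splittings_uniq x s : uniq (splittings x s).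
Proof.
elim: s x => [|y s IH] x //=; rewrite cat_uniq map_inj_uniq ?IH;
  last by move=> ? ? [].
case: ifP => //= _; apply/andP; split.
  (* The branches are disjoint: the first path has one vertex in one of them and at least two in the
     other. *)
  apply/hasPn => ss /mapP[r + ->]; rewrite mem_splittings.
  case: r => [|[|z p] r]; rewrite /= ?andbF // => _.
  by apply/mapP => -[].
rewrite map_inj_in_uniq // => -[|p r] [|q t]; rewrite !mem_splittings //=.
by move=> _ _ [-> ->].
Qed.

(** Each cut contributes ['X] and each kept edge [a]. The kept edges number [size s - (size ss).-1];
    since [a * a = 1], the exponent may be the sum instead of the difference. *)
Lemma sum_splittings (a : rat) x s : a * a = 1 ->
  \sum_(ss <- splittings x s) a ^+ (size s + (size ss).-1) *: 'X^((size ss).-1)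
    = \prod_(b <- pairmap e x s) ('X + (a *+ b)%:P).
Proof.
move=> a2; elim: s x => [|y s IH] x /=.
  by rewrite big_seq1 big_nil /= scale1r.
rewrite big_cons big_cat /= big_map mulrDl -IH mulr_sumr; congr (_ + _).
  rewrite !big_seq; apply: eq_bigr => -[|p ss]; rewrite mem_splittings //= => _.
  by rewrite addSn addnS !exprS mulrA a2 mul1r scalerAr.
case: ifP => exy; last by rewrite big_nil mulr0n mul0r.
rewrite big_map mulr_sumr !big_seq; apply: eq_bigr => -[|p ss] _ /=;
  by rewrite mul_polyC scalerA -exprS mulr1n.
Qed.

End LinearSplittings.

(** Matches linear orders with lists of disjoint paths. Repeated empty lists must be excluded, as
    they leave no trace in [flatten ss]. *)
Lemma flatten_uniqP (T : eqType) (ss : seq (seq T)) : [::] \notin ss ->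
  uniq (flatten ss) <->
  [/\ all uniq ss, uniq ss
    & forall x p q, p \in ss -> q \in ss -> x \in p -> x \in q -> p = q].
Proof.
elim: ss => [|p ss IH] //; rewrite inE negb_or => /andP[p0 /IH{}IH].
rewrite /= cat_uniq; split.
  case/and3P => -> /hasPn disj /IH[-> -> inj].
  have disj' q x : q \in ss -> x \in q -> x \in p -> False.
    move=> qss xq xp; have xss : x \in flatten ss by apply/flattenP; exists q.
    by have /negP := disj x xss; apply.
  rewrite !andbT; split=> //.
    apply/negP => pss; move: p0; case Ep: p => [|x s] // _.
    by apply: (disj' _ x pss); rewrite Ep inE eqxx.
  move=> x q r; rewrite !inE => /predU1P[->|qss] /predU1P[->|rss] // xq xr.
  - by case: (disj' r x).
  - by case: (disj' q x).
  - exact: inj xq xr.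
case=> /andP[-> uss] /andP[pss Uss] inj.
apply/andP; split=> //; apply/andP; split.
  apply/hasPn => x /flattenP[q qss xq]; apply/negP => /= xp.
  move: pss; rewrite (inj x p q) ?qss // inE ?eqxx // qss ?orbT //.
apply/IH; split=> // x q r qss rss; apply: inj; rewrite inE ?qss ?rss orbT //.
Qed.

Lemma leq_size_flatten (T : eqType) (ss : seq (seq T)) :
  [::] \notin ss -> (size ss <= size (flatten ss))%N.
Proof.
elim: ss => [|[|x p] ss IH] //=; rewrite inE size_cat => /IH le_ss.
by rewrite ltnS (leq_trans le_ss) ?leq_addl.
Qed.

(** * Counting path covers through their orderings *)

Section OrderedCovers.
Variables (T : finType) (e : rel T).
Hypothesis T_gt0 : (0 < #|T|)%N.

Definition ordered_covers : seq (seq (seq T)) :=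
  [seq ss | w <- permutations (enum T),
            ss <- if w is x :: s then splittings e x s else [::]].

Lemma permutation_enum_size w : w \in permutations (enum T) -> size w = #|T|.
Proof. by rewrite mem_permutations => /perm_size; rewrite -cardE. Qed.

Lemma mem_ordered_covers ss :
  (ss \in ordered_covers) =
  perm_eq (flatten ss) (enum T) && all (is_path e) ss.
Proof.
apply/allpairsPdep/andP => [[w [r [win rin ->]]]|[flat ssp]].
  case: w win rin => // x s; rewrite mem_splittings mem_permutations.
  by move=> wp /andP[/eqP -> ->].
exists (flatten ss), ss; rewrite mem_permutations flat; split=> //.
case E: (flatten ss) => [|x s]; last by rewrite mem_splittings E eqxx.
by move: T_gt0; rewrite cardE -(perm_size flat) E.
Qed.

(** Flattening a splitting recovers the linear order, so different orders share no splitting. *)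
Lemma ordered_covers_uniq : uniq ordered_covers.
Proof.
apply: (@allpairs_uniq_dep _ (fun=> seq (seq T)) _ (fun _ ss => ss)).
- exact: permutations_uniq.
- by move=> [|x s] // _; apply: splittings_uniq.
have flat w ss : ss \in (if w is x :: s then splittings e x s else [::]) ->
    flatten ss = w.
  by case: w => // x s; rewrite mem_splittings => /andP[/eqP].
move=> _ _ /allpairsPdep[w [r [_ /flat rw ->]]]
  /allpairsPdep[w' [r' [_ /flat rw' ->]]].
by move=> /= E; rewrite -rw -rw' E.
Qed.

Lemma nil_notin ss : all (is_path e) ss -> [::] \notin ss.
Proof. by move/allP=> ssp; apply/negP => /ssp. Qed.

Lemma ordered_cover_size ss :
  ss \in ordered_covers -> (0 < size ss <= #|T|)%N.
Proof.
rewrite mem_ordered_covers cardE => /andP[/perm_size flat /nil_notin].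
move/leq_size_flatten; rewrite flat => ->; rewrite andbT lt0n.
by apply: contraTneq T_gt0 => /size0nil ss0; rewrite cardE -flat ss0.
Qed.

Lemma path_cover_flatten (ts : seq (#|T|.-bseq T)) :
  uniq ts && path_cover e [set t in ts] = (map val ts \in ordered_covers).
Proof.
rewrite mem_ordered_covers.
have pathE : all (dpath e) (map val ts) =
    all (is_path e) (map val ts) && all uniq (map val ts).
  by rewrite -all_predI; apply: eq_all => -[|x s].
apply/idP/andP => [/andP[U /and3P[dp dis cov]]|[flat isp]].
  have dpts : all (dpath e) (map val ts).
    apply/allP => _ /mapP[t tts ->]; apply: (forall_inP dp); by rewrite inE.
  rewrite pathE in dpts; have /andP[isp un] := dpts; split=> //.
  apply: uniq_perm (enum_uniq _) _.
    apply/flatten_uniqP; first exact: nil_notin.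
    split=> //; first by rewrite map_inj_uniq //; apply: val_inj.
    move=> x _ _ /mapP[p pts ->] /mapP[q qts ->] xp xq; congr val; apply/eqP.
    apply: contraLR xq => neq.
    move/forall_inP/(_ p): dis; rewrite inE => /(_ pts)/forall_inP/(_ q).
    rewrite inE => /(_ qts).
    by rewrite neq /= disjoint_has => /hasPn/(_ x xp).
  move=> x; rewrite mem_enum; apply/flattenP.
  have /forallP/(_ x)/exists_inP[t] := cov; rewrite inE => tts xt.
  by exists (val t) => //; apply: map_f.
have flatU : uniq (flatten (map val ts)) by rewrite (perm_uniq flat) enum_uniq.
have [un U inj] := (flatten_uniqP (nil_notin isp)).1 flatU.
rewrite (map_uniq U) /=; apply/and3P; split.
- apply/forall_inP => t; rewrite inE => tts.
  have /allP := pathE; rewrite isp un => /(_ (val t)); apply; exact: map_f.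
- apply/forall_inP => p; rewrite inE => pts; apply/forall_inP => q.
  rewrite inE => qts; apply/implyP; apply: contraR.
  rewrite disjoint_has negbK => /hasP[x xp xq].
  by apply/eqP/val_inj/(inj x); rewrite ?map_f.
apply/forallP => x.
have : x \in flatten (map val ts) by rewrite (perm_mem flat) mem_enum.
case/flattenP => _ /mapP[t tts ->] xt; apply/exists_inP; exists t => //.
by rewrite inE.
Qed.

(** Double count of the tuples in [A]: [map val] identifies them with the ordered covers by [k]
    paths, and forgetting the order reaches each cover k! times. *)
Lemma count_ordered_covers k :
  count (fun ss => size ss == k) ordered_covers = (num_path_covers e k * k`!)%N.
Proof.
pose A :=
  [set t : k.-tuple (#|T|.-bseq T) | uniq t && path_cover e [set s in t]].
transitivity #|A|.
  rewrite -size_filter cardE.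
  have inj : injective (fun t : k.-tuple (#|T|.-bseq T) => map val t).
    by move=> t u /(inj_map val_inj)/val_inj.
  rewrite -(size_map (fun t : k.-tuple (#|T|.-bseq T) => map val t)).
  apply: perm_size; apply: uniq_perm.
  - by rewrite filter_uniq // ordered_covers_uniq.
  - by rewrite map_inj_uniq // enum_uniq.
  move=> ss; rewrite mem_filter.
  apply/andP/mapP => [[/eqP sz ssin]|[t]]; last first.
    rewrite mem_enum inE path_cover_flatten => tin ->.
    by rewrite size_map size_tuple.
  (* A path of an ordered cover has no repeated vertex, so it fits the length bound of the bounded
     sequences. *)
  have szp p : p \in ss -> (size p <= #|T|)%N.
    move=> pss; rewrite cardE uniq_leq_size // => [|x _];
      last by rewrite mem_enum.
    move: ssin; rewrite mem_ordered_covers => /andP[/perm_uniq].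
    rewrite enum_uniq; case/splitPr: pss => s1 s2.
    by rewrite flatten_cat /= !cat_uniq => /and3P[_ _ /andP[]].
  pose ts := map (@insub_bseq #|T| T) ss.
  have tsE : map val ts = ss.
    rewrite -map_comp -[RHS]map_id; apply/eq_in_map => p /szp lep /=.
    by rewrite /insub_bseq insubdK.
  have szt : size ts == k by rewrite size_map sz.
  exists (Tuple szt); last by rewrite /= tsE.
  by rewrite mem_enum inE path_cover_flatten /= tsE.
rewrite -sum1_card.
pose PC := [set C : {set #|T|.-bseq T} | path_cover e C & #|C| == k].
rewrite (partition_big (fun t : k.-tuple _ => [set s in t]) [in PC]) /=; last first.
  move=> t; rewrite !inE => /andP[U ->] /=.
  by rewrite cardsE (card_uniqP U) size_tuple.
have -> : num_path_covers e k = (\sum_(C in PC) 1)%N by rewrite sum1_card.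
rewrite big_distrl /=.
apply: eq_bigr => C; rewrite inE => /andP[PC_C /eqP Ck].
have -> : (1 * k`! = #|C| ^_ k)%N by rewrite mul1n Ck ffactnn.
rewrite -card_uniq_tuples -[RHS]sum1_card.
apply: eq_bigl => t; rewrite !inE.
apply/andP/andP => [[/andP[U _] /eqP <-]|[tC U]].
  split=> //; apply/allP => s st.
  by have : s \in [set s in t] by rewrite inE.
(* A repetition-free [k]-tuple in the [k]-element set [C] exhausts it. *)
have -> : [set s in t] = C.
  apply/eqP; rewrite eqEcard cardsE (card_uniqP U) size_tuple Ck leqnn andbT.
  by apply/subsetP => s; rewrite inE => /(allP tC).
by rewrite U PC_C eqxx.
Qed.

End OrderedCovers.

(** * Duality for path covers *)

Section Duality.
Variable T : finType.
Hypothesis T_gt0 : (0 < #|T|)%N.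
Implicit Type e : rel T.

(** For [a = 1] or [a = -1], the signed generating function of the splittings of [w] by number of
    cuts; the empty order has none. *)
Definition adjacency_poly e (a : rat) (w : seq T) : {poly rat} :=
  if w is x :: s then \prod_(b <- pairmap e x s) ('X + (a *+ b)%:P) else 0.

Lemma path_covers_adjacency e (a : rat) : a * a = 1 ->
  \sum_(1 <= k < #|T|.+1) (a ^+ (#|T| - k) * (num_path_covers e k)%:R) *: 'X^k
    = exp_shift (\sum_(w <- permutations (enum T)) adjacency_poly e a w).
Proof.
move=> a2; pose F k := a ^+ (#|T|.-1 + k.-1) *: 'X^(k.-1) : {poly rat}.
have -> : \sum_(w <- permutations (enum T)) adjacency_poly e a w
    = \sum_(ss <- ordered_covers e) F (size ss).
  rewrite /ordered_covers big_allpairs_dep big_seq [RHS]big_seq.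
  apply: eq_bigr => -[|x s] /permutation_enum_size w_sz.
    by rewrite big_nil.
  by rewrite /= -sum_splittings // /F -w_sz.
rewrite [X in exp_shift X]big_seq (@sum_by_value _ _ _ _ _ F #|T|); last first.
  exact: ordered_cover_size.
rewrite linear_sum !big_nat; apply: eq_bigr => -[|k] // /andP[_ le_k].
have -> : count (fun ss => (ss \in ordered_covers e) && (size ss == k.+1))
    (ordered_covers e) = (num_path_covers e k.+1 * k.+1`!)%N.
  by rewrite -count_ordered_covers //; apply: eq_in_count => ss ->.
rewrite linearMn linearZ /= exp_shiftXn -scaler_nat !scalerA; congr (_ *: _).
(* The two exponents of [a] differ by the even number [2 * k]. *)
have -> : (#|T|.-1 + k = #|T| - k.+1 + 2 * k)%N by lia.
rewrite exprD exprM expr2 a2 expr1n mulr1 natrM mulrAC mulfK 1?mulrC //.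
by rewrite pnatr_eq0 -lt0n fact_gt0.
Qed.

(** Neighbours in [w] are distinct, so [compl e] negates [e] on them, and each factor satisfies ('X
    + 1) - [not e x y] = 'X + [e x y]. *)
Lemma adjacency_poly_compl e w : uniq w ->
  adjacency_poly (compl e) (-1) w \Po ('X + 1) = adjacency_poly e 1 w.
Proof.
case: w => [|x s] /=; first by rewrite comp_poly0.
elim: s x => [|y s IH] x /=; first by rewrite !big_nil comp_polyC.
rewrite inE negb_or -andbA => /and3P[neq _ us].
rewrite !big_cons comp_polyM IH //; congr (_ * _).
rewrite comp_polyD comp_polyX comp_polyC /compl /= neq -addrA; congr (_ + _).
by case: (e x y); rewrite /= ?mulr0n ?mulr1n ?addr0 // polyCN subrr.
Qed.

Lemma path_cover_dual e :
  path_cover_poly e = exp_tD2 (signed_path_cover_poly (compl e)).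
Proof.
rewrite /signed_path_cover_poly path_covers_adjacency ?mulrNN ?mulr1 //.
rewrite exp_tD2_exp_shift.
transitivity (exp_shift
  (\sum_(w <- permutations (enum T)) adjacency_poly e 1 w)).
  rewrite -path_covers_adjacency ?mulr1 //; apply: eq_bigr => k _.
  by rewrite expr1n mul1r.
congr exp_shift; rewrite raddf_sum !big_seq; apply: eq_bigr => w.
rewrite mem_permutations => /perm_uniq; rewrite enum_uniq => uw.
by rewrite -adjacency_poly_compl.
Qed.

End Duality.

Theorem theorem1p1 (T : finType) (e : rel T)
    (e_sym : symmetric e) (e_irr : irreflexive e) (T_gt0 : (0 < #|T|)%N) :
  [/\ path_cover_poly e = exp_tD2 (signed_path_cover_poly (compl e)),
      forall phi_chi : {linear {poly rat} -> {poly rat}},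
        (forall n : nat, phi_chi 'X^n = falling_poly n) ->
        chromatic_poly e = phi_chi (clique_cover_poly (compl e))
    & forall phi_xi : {linear {poly rat} -> {poly rat}},
        (forall n : nat, (1 <= n)%N ->
           phi_xi 'X^n = \sum_(1 <= k < n.+1) (stirling2 n k)%:R *: 'X^k) ->
        clique_cover_poly e = phi_xi (chromatic_poly (compl e))].
Proof.
split=> [|phi_chi|phi_xi].
- exact: path_cover_dual.
- exact: chromatic_dual.
- exact: clique_cover_dual.
Qed.
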